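(* Let $\mathbb{F}$ be a field and $[\Gamma,i,j]:P\to Q$ an $\mathbb{F}$-IO-network morphism that admits an elementary factorization. Then $\operatorname{rank}X([\Gamma,i,j])=2m([\Gamma,i,j])$, $\dim\ker X([\Gamma,i,j])=|P|-m([\Gamma,i,j])$, and $\dim\operatorname{im}\overline{X([\Gamma,i,j])}=|P|+m([\Gamma,i,j])$. The same holds with $P$ and $Q$ reversed (i.e. $\dim\ker\overline{X([\Gamma,i,j])}=|Q|-m([\Gamma,i,j])$ and $\dim\operatorname{im}X([\Gamma,i,j])=|Q|+m([\Gamma,i,j])$).
   Context: Graphs are finite undirected multigraphs with vertex set $V$ and oriented edge set $E$ (endpoints $e_\pm$, reverse $\overline e$). An IO-graph morphism $[G,i,j]:P\to Q$ between finite sets is a finite graph $G$ with injective maps $i:P\to V$, $j:Q\to V$ (up to isomorphism of graphs commuting with $i,j$); vertices of $i(P)$ are inputs, of $j(Q)$ outputs; $G$ is regarded as a $\partial$-graph with $\partial V=i(P)\cup j(Q)$. The composite of $[G,i,j]:P\to Q$ and $[G',i',j']:Q\to R$ is obtained from the disjoint union of $G$ and $G'$ by identifying $j(q)$ with $i'(q)$ for each $q\in Q$, with labels $i$ and $j'$. An $\mathbb{F}$-IO-network is the same with edge weights $w:E\to\mathbb{F}\setminus\{0\}$, $w(e)=w(\overline e)$, preserved by isomorphisms. For $[\Gamma,i,j]:P\to Q$, $X([\Gamma,i,j])\subset(\mathbb{F}^P)^2\times(\mathbb{F}^Q)^2$ is the set of $((x_1,x_2),(y_1,y_2))$ for which there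 is $u:V\to\mathbb{F}$ with $u(i(p))=x_1(p)$, $u(j(q))=y_1(q)$ for all $p,q$, and $\Delta u(v)=\sum_{q:j(q)=v}y_2(q)-\sum_{p:i(p)=v}x_2(p)$ for every $v\in V$, where $\Delta u(v)=\sum_{e:e_+=v}w(e)(u(e_+)-u(e_-))$. For a linear relation $T\subset A\times B$: $\ker T=\{x:(x,0)\in T\}$, $\operatorname{im}T=\{y:\exists x,(x,y)\in T\}$, $\overline T=\{(y,x):(x,y)\in T\}$, $\operatorname{rank}T=\dim\operatorname{im}\overline T-\dim\ker T$. A connection from $A$ to $B$ ($A,B\subset V$) is a set of vertex-disjoint paths, each starting in $A$ with no other vertex in $A$ and ending in $B$ with no other vertex in $B$ (one-vertex paths allowed for vertices of $A\cap B$); $m([\Gamma,i,j])$ is the maximum size of a connection from $i(P)$ to $j(Q)$. Elementary morphisms: type 1: each component is either an isolated vertex which is both an input and an output, or two vertices joined by one edge, one endpoint an input and the other an output; type 2: every vertex is both an input and an output (with arbitrary edges among them); type 3: no edges, every vertex is an input, not all are outputs (the non-outputs are input stubs); type 4: no edges, every vertex is an output, not all are inputs (non-inputs are output stubs). An elementary factorization is a factorization $[\Gamma,i,j]=[\Gamma_n,i_n,j_n]\circ\cdots\circ[\Gamma_1,i_1,j_1]$ into elementary morphisms (with weights) in which all type 3 factors come before all type 4 factors. *)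

(* Defs.v *)
From HB Require Import structures.
From mathcomp Require Import all_boot all_order all_algebra.
From mathcomp Require Import generic_quotient.

Set Implicit Arguments.
Unset Strict Implicit.
Unset Printing Implicit Defensive.

Import GRing.Theory.
Local Open Scope ring_scope.
Local Open Scope quotient_scope.

(* Every undirected edge, loops included, is a pair {e, erev e} of two distinct
   oriented edges; multiple edges are allowed.  The head is e_+. *)
Record mgraph := MGraph {
  vertex : finType;
  oedge : finType;
  ehead : oedge -> vertex;
  erev : oedge -> oedge;
  erevK : involutive erev;
  erev_neq : forall e, erev e != e
}.
Arguments ehead {m}.
Arguments erev {m}.

(* e_- = (reverse of e)_+ *)
Definition etail (G : mgraph) (e : oedge G) : vertex G := ehead (erev e).

(* Representatives of the IO-network morphisms P -> Q, which are the classes of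
   these under [ionet_iso] below. *)
Record ionet (F : fieldType) (P Q : finType) := IONet {
  igraph :> mgraph;
  weight : oedge igraph -> F;
  weight_neq0 : forall e, weight e != 0;
  weight_rev : forall e, weight (erev e) = weight e;
  inp : P -> vertex igraph;
  outp : Q -> vertex igraph;
  inp_inj : injective inp;
  outp_inj : injective outp
}.

Section Networks.
Variable F : fieldType.

Definition inputs P Q (N : ionet F P Q) : {set vertex N} :=
  [set inp N p | p : P].
Definition outputs P Q (N : ionet F P Q) : {set vertex N} :=
  [set outp N q | q : Q].

Definition ionet_iso P Q (N N' : ionet F P Q) : Prop :=
  exists (f : vertex N -> vertex N') (g : oedge N -> oedge N'),
    [/\ bijective f, bijective g,
        (forall e, ehead (g e) = f (ehead e)) /\
        (forall e, g (erev e) = erev (g e)),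
        (forall e, weight (g e) = weight e) &
        (forall p, f (inp N p) = inp N' p) /\
        (forall q, f (outp N q) = outp N' q)].

Section Composition.
Variables (P Q R : finType) (N1 : ionet F P Q) (N2 : ionet F Q R).

(* The equivalence relation on the disjoint union generated by
   inl (outp N1 q) ~ inr (inp N2 q): because [outp N1] and [inp N2] are
   injective, nothing else gets identified. *)
Definition glue (x y : vertex N1 + vertex N2) : bool :=
  match x, y with
  | inl a, inl b => a == b
  | inr a, inr b => a == b
  | inl a, inr b | inr b, inl a =>
      [exists q, (outp N1 q == a) && (inp N2 q == b)]
  end.

Lemma glue_refl : reflexive glue.
Proof. by case=> a /=. Qed.

Lemma glue_sym : symmetric glue.
Proof. by case=> a [] b //=; rewrite eq_sym. Qed.

Lemma glue_trans : transitive glue.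
Proof.
case=> b [] a [] c //=.
- by move=> /eqP->.
- by move=> /eqP->.
- move=> /existsP[q /andP[/eqP ha /eqP hb]].
  move=> /eqP bc; apply/existsP; exists q; rewrite ha -bc; apply/andP.
  by split=> //; apply/eqP.
- move=> /existsP[q /andP[/eqP ha /eqP hb]].
  move=> /existsP[q' /andP[/eqP ha' /eqP hb']].
  by rewrite -hb -hb' (outp_inj (etrans ha (esym ha'))).
- move=> /existsP[q /andP[/eqP ha /eqP hb]].
  move=> /existsP[q' /andP[/eqP ha' /eqP hb']].
  by rewrite -ha -ha' (inp_inj (etrans hb (esym hb'))).
- move=> /existsP[q /andP[/eqP ha /eqP hb]].
  by move=> /eqP bc; apply/existsP; exists q; rewrite ha hb bc !eqxx.
- by move=> /eqP->.
- by move=> /eqP->.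
Qed.

Canonical glue_equiv := EquivRel glue glue_refl glue_sym glue_trans.

Definition comp_vertex := {eq_quot glue_equiv}.
HB.instance Definition _ := [Finite of comp_vertex by <:%/].

Definition comp_edge : finType := (oedge N1 + oedge N2)%type.

Definition comp_head (e : comp_edge) : comp_vertex :=
  match e with
  | inl a => \pi_comp_vertex (inl (ehead a))
  | inr b => \pi_comp_vertex (inr (ehead b))
  end.

Definition comp_rev (e : comp_edge) : comp_edge :=
  match e with inl a => inl (erev a) | inr b => inr (erev b) end.

Lemma comp_revK : involutive comp_rev.
Proof. by case=> e /=; rewrite erevK. Qed.

Lemma comp_rev_neq e : comp_rev e != e.
Proof. by case: e => e /=; apply/eqP=> -[] /eqP; rewrite (negPf (erev_neq e)). Qed.

Definition comp_graph : mgraph :=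
  @MGraph comp_vertex comp_edge comp_head comp_rev comp_revK comp_rev_neq.

Definition comp_weight (e : oedge comp_graph) : F :=
  match e with inl a => weight a | inr b => weight b end.

Lemma comp_weight_neq0 e : comp_weight e != 0.
Proof. by case: e => e; apply: weight_neq0. Qed.

Lemma comp_weight_rev e : comp_weight (erev e) = comp_weight e.
Proof. by case: e => e; apply: weight_rev. Qed.

Definition comp_inp (p : P) : vertex comp_graph :=
  \pi_comp_vertex (inl (inp N1 p)).
Definition comp_outp (r : R) : vertex comp_graph :=
  \pi_comp_vertex (inr (outp N2 r)).

Lemma comp_inp_inj : injective comp_inp.
Proof. by move=> p p' /eqmodP /= /eqP; apply: inp_inj. Qed.

Lemma comp_outp_inj : injective comp_outp.
Proof. by move=> r r' /eqmodP /= /eqP; apply: outp_inj. Qed.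

(* N2 o N1: N1 is applied first. *)
Definition ionet_comp : ionet F P R :=
  IONet comp_weight_neq0 comp_weight_rev comp_inp_inj comp_outp_inj.

End Composition.

Section Elementary.
Variables (P Q : finType) (N : ionet F P Q).

Definition adjacent (v w : vertex N) : bool :=
  [exists e : oedge N, (etail e == v) && (ehead e == w)].

Definition component (v : vertex N) : {set vertex N} :=
  [set w | connect adjacent v w].

Definition isolated (v : vertex N) : bool :=
  [forall e : oedge N, ehead e != v].

(* In a two-vertex component, each endpoint carries exactly one of the two
   roles. *)
Definition type1 : bool :=
  [forall v : vertex N,
    [&& isolated v, v \in inputs N & v \in outputs N]
    || [exists e : oedge N,
         [&& etail e != ehead e,
             component v == [set etail e; ehead e],
             [set f : oedge N | ehead f \in component v] == [set e; erev e],
             etail e \in inputs N :\: outputs N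
           & ehead e \in outputs N :\: inputs N]]].

Definition type2 : bool :=
  (inputs N == [set: vertex N]) && (outputs N == [set: vertex N]).

Definition type3 : bool :=
  [&& #|oedge N| == 0%N, inputs N == [set: vertex N]
    & outputs N != [set: vertex N]].

Definition type4 : bool :=
  [&& #|oedge N| == 0%N, outputs N == [set: vertex N]
    & inputs N != [set: vertex N]].

Definition elementary : bool := [|| type1, type2, type3 | type4].

End Elementary.

(* A nonempty composable sequence N_1, ..., N_n, with N_1 starting at P. *)
Inductive chain : finType -> finType -> Type :=
| Chain1 P Q : ionet F P Q -> chain P Q
| ChainCons P R Q : ionet F P R -> chain R Q -> chain P Q.

(* N_n o ... o N_1 *)
Fixpoint chain_comp P Q (c : chain P Q) : ionet F P Q :=
  match c with
  | Chain1 _ _ N => N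
  | ChainCons _ _ _ N c' => ionet_comp N (chain_comp c')
  end.

Fixpoint chain_all (p : forall P Q, ionet F P Q -> bool) P Q (c : chain P Q)
  : bool :=
  match c with
  | Chain1 _ _ N => p _ _ N
  | ChainCons _ _ _ N c' => p _ _ N && chain_all p c'
  end.

(* If N_k has type 4 and l > k then N_l does not have type 3. *)
Fixpoint type3_before_type4 P Q (c : chain P Q) : bool :=
  match c with
  | Chain1 _ _ N => true
  | ChainCons _ _ _ N c' =>
      (type4 N ==> chain_all (fun P Q (N' : ionet F P Q) => ~~ type3 N') c')
      && type3_before_type4 c'
  end.

Definition has_elementary_factorization P Q (N : ionet F P Q) : Prop :=
  exists c : chain P Q,
    [/\ chain_all elementary c, type3_before_type4 c
      & ionet_iso N (chain_comp c)].

End Networks.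

Section Connections.
Variable G : mgraph.

Fixpoint walk (v : vertex G) (es : seq (oedge G)) : bool :=
  match es with
  | [::] => true
  | e :: es' => (etail e == v) && walk (ehead e) es'
  end.

(* A starting vertex and a sequence of edges.  Bounding the number of edges by
   #|V| excludes no path, since paths do not repeat vertices; it makes [gpath],
   hence [{set gpath}], finite. *)
Definition gpath : finType := (vertex G * #|vertex G|.-bseq (oedge G))%type.

Definition path_tail (c : gpath) : seq (vertex G) := map ehead c.2.
Definition path_vertices (c : gpath) : seq (vertex G) := c.1 :: path_tail c.
Definition is_path (c : gpath) : bool := walk c.1 c.2 && uniq (path_vertices c).

Definition joins (A B : {set vertex G}) (c : gpath) : bool :=
  [&& c.1 \in A, all [pred v | v \notin A] (path_tail c),
      last c.1 (path_tail c) \in B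
    & all [pred v | v \notin B] (belast c.1 (path_tail c))].

Definition connection (A B : {set vertex G}) (C : {set gpath}) : bool :=
  [forall c in C, is_path c && joins A B c]
  && [forall c in C, forall d in C,
       (c != d) ==> [disjoint path_vertices c & path_vertices d]].

Definition max_connection (A B : {set vertex G}) : nat :=
  \max_(C : {set gpath} | connection A B C) #|C|.

End Connections.

Definition mconn (F : fieldType) (P Q : finType) (N : ionet F P Q) : nat :=
  max_connection (inputs N) (outputs N).

Section LinearRelations.
Variables (F : fieldType) (A B : vectType F).

Definition rel_ker (T : {vspace A * B}) : {vspace A} :=
  (linfun (fun x : A => (x, 0 : B)) @^-1: T)%VS.
Definition rel_im (T : {vspace A * B}) : {vspace B} :=
  (linfun (fun z : A * B => z.2) @: T)%VS.
Definition rel_conv (T : {vspace A * B}) : {vspace B * A} :=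
  (linfun (fun z : A * B => (z.2, z.1)) @: T)%VS.

(* [linfun f] is only meaningful for linear [f], so the membership conditions
   are checked here. *)
Lemma mem_rel_ker (T : {vspace A * B}) x : (x \in rel_ker T) = ((x, 0) \in T).
Proof.
have lin : linear (fun x : A => (x, 0 : B)).
  by move=> a u v; apply/eqP; rewrite xpair_eqE /= scaler0 addr0 !eqxx.
pose L := GRing.isLinear.Build _ _ _ _ _ lin.
pose f : {linear A -> (A * B)%type} := HB.pack (fun x : A => (x, 0 : B)) L.
by rewrite -memv_preim (lfunE f).
Qed.

Lemma mem_rel_im (T : {vspace A * B}) y :
  reflect (exists x, (x, y) \in T) (y \in rel_im T).
Proof.
pose f : {linear (A * B)%type -> B} := snd.
apply: (iffP memv_imgP) => [[[x y'] zT ->]|[x xyT]].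
  by exists x; rewrite (lfunE f).
by exists (x, y); rewrite ?(lfunE f).
Qed.

Lemma mem_rel_conv (T : {vspace A * B}) x y :
  ((y, x) \in rel_conv T) = ((x, y) \in T).
Proof.
have lin : linear (fun z : A * B => (z.2, z.1)) by [].
pose L := GRing.isLinear.Build _ _ _ _ _ lin.
pose f : {linear (A * B)%type -> (B * A)%type} :=
  HB.pack (fun z : A * B => (z.2, z.1)) L.
apply/memv_imgP/idP => [[[x' y'] zT]|xyT].
  by rewrite (lfunE f) => -[-> ->].
by exists (x, y); rewrite ?(lfunE f).
Qed.

End LinearRelations.

Definition rel_rank (F : fieldType) (A B : vectType F) (T : {vspace A * B})
  : int :=
  (\dim (rel_im (rel_conv T)))%:Z - (\dim (rel_ker T))%:Z.

(* F^P, and boundary data (F^P)^2 *)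
Notation fspace F P := {ffun P -> F^o}.
Notation bdspace F P := (fspace F P * fspace F P)%type.

Section Behavior.
Variables (F : fieldType) (P Q : finType) (N : ionet F P Q).

Definition laplacian (u : fspace F (vertex N)) (v : vertex N) : F :=
  \sum_(e : oedge N | ehead e == v) weight e * (u (ehead e) - u (etail e)).

Definition net_current (x : bdspace F P) (y : bdspace F Q) (v : vertex N) : F :=
  \sum_(q | outp N q == v) y.2 q - \sum_(p | inp N p == v) x.2 p.

Definition behavior_rel (x : bdspace F P) (y : bdspace F Q) : Prop :=
  exists u : fspace F (vertex N),
    [/\ forall p, u (inp N p) = x.1 p,
        forall q, u (outp N q) = y.1 q
      & forall v, laplacian u v = net_current x y v].

(* X(N) is [behavior_rel] as a linear subspace (see [mem_behavior]): the
   projection of the solution space of the defining equations. *)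
Definition behavior_defect (z : fspace F (vertex N) * (bdspace F P * bdspace F Q))
  : fspace F P * fspace F Q * fspace F (vertex N) :=
  ([ffun p => z.1 (inp N p) - z.2.1.1 p],
   [ffun q => z.1 (outp N q) - z.2.2.1 q],
   [ffun v => laplacian z.1 v - net_current z.2.1 z.2.2 v]).

Definition behavior : {vspace bdspace F P * bdspace F Q} :=
  (linfun (fun z : fspace F (vertex N) * (bdspace F P * bdspace F Q) => z.2)
     @: lker (linfun behavior_defect))%VS.

Lemma behavior_defect_linear : linear behavior_defect.
Proof.
move=> a [u [[x1 x2] [y1 y2]]] [u' [[x1' x2'] [y1' y2']]].
rewrite /behavior_defect /=; congr (_, _, _); apply/ffunP=> v; rewrite !ffunE /=.
- by rewrite scalerBr opprD !addrA; congr (_ + _); rewrite addrAC.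
- by rewrite scalerBr opprD !addrA; congr (_ + _); rewrite addrAC.
have lapD : laplacian (a *: u + u') v = a * laplacian u v + laplacian u' v.
  rewrite /laplacian mulr_sumr -big_split /=; apply: eq_bigr => e _.
  rewrite !ffunE /= opprD addrACA mulrDr; congr (_ + _).
  by rewrite -scalerBr mulrCA.
have sumD (I : finType) (r : pred I) (y y' : fspace F I) :
    \sum_(i | r i) (a *: y + y') i
    = a * (\sum_(i | r i) y i) + \sum_(i | r i) y' i :> F.
  by rewrite mulr_sumr -big_split /=; apply: eq_bigr => i _; rewrite !ffunE.
rewrite lapD /net_current /= !sumD.
rewrite -[X in _ = X + _]/(a * (_ - _)) !mulrBr !opprD !opprK !addrA.
set b := a * laplacian _ _; set c := laplacian _ _.
set d := a * _; set f := \sum_(_ | _) _; set g := a * _; set h := \sum_(_ | _) _.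
by rewrite [LHS](ACl (1*3*5*2*4*6)).
Qed.

Lemma mem_behavior x y : (x, y) \in behavior <-> behavior_rel x y.
Proof.
pose L := GRing.isLinear.Build _ _ _ _ _ behavior_defect_linear.
pose f : {linear _ -> _} := HB.pack behavior_defect L.
pose s : {linear (fspace F (vertex N) * (bdspace F P * bdspace F Q))%type -> _} := snd.
split.
  case/memv_imgP=> -[u [x' y']]; rewrite memv_ker (lfunE f) (lfunE s) /=.
  move=> /eqP dz [-> ->]; exists u; case: dz => dx dy dv.
  split=> [p|q|v]; apply/eqP; rewrite -subr_eq0; apply/eqP.
  - by move/ffunP: dx => /(_ p); rewrite !ffunE.
  - by move/ffunP: dy => /(_ q); rewrite !ffunE.
  - by move/ffunP: dv => /(_ v); rewrite !ffunE.
case=> u [hx hy hv]; apply/memv_imgP; exists (u, (x, y)); last by rewrite (lfunE s).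
rewrite memv_ker (lfunE f) /= /behavior_defect; apply/eqP.
by congr (_, _, _); apply/ffunP=> v; rewrite !ffunE /= (hx, hy, hv) subrr.
Qed.

End Behavior.

(* Main.v *)
(* Call a network [good] for k if its behavior has the asserted dimensions with
   k in place of m, it carries k disjoint paths from inputs to outputs, and some
   set of at most k vertices meets every path from inputs to outputs; then m = k.
   Behaviors compose as linear relations.  The behavior of a network of type 1, 2
   or 3 is single-valued and onto (F^Q)^2, with kernel of dimension |P| - |Q|;
   such a network is good for |Q|, and precomposing with it keeps k.  Conversely,
   a network of type 1, 2 or 4 has a single-valued inverse, defined on all of
   (F^P)^2; it is good for |P|, and composing such networks keeps the |P| of the
   first.  In the factorization all factors before the first one of type 4 have
   types 1, 2, 3, and all those from it on have types 1, 2, 4.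

   Only kernels are computed for the elementary networks.  The behavior has
   dimension at least |P| + |Q| when every vertex is an input or an output, and
   rank-nullity for both projections then gives the images. *)
Require Import Defs.
From HB Require Import structures.
From mathcomp Require Import all_boot all_order all_algebra.
From mathcomp Require Import generic_quotient zify.

Set Implicit Arguments.
Unset Strict Implicit.
Unset Printing Implicit Defensive.

Import GRing.Theory.
Local Open Scope ring_scope.
Local Open Scope quotient_scope.

(** * Dimension counts for linear relations *)

Section Relations.
Variables (F : fieldType) (A B : vectType F).
Implicit Type T : {vspace A * B}.

Let pr1 : {linear (A * B)%type -> A} := fst.
Let pr2 : {linear (A * B)%type -> B} := snd.

Lemma rel_convK T : rel_conv (rel_conv T) = T.
Proof. by apply/vspaceP=> -[x y]; rewrite !mem_rel_conv. Qed.

Lemma mem_rel_im_conv T x :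
  reflect (exists y, (x, y) \in T) (x \in rel_im (rel_conv T)).
Proof.
by apply: (iffP (mem_rel_im _ _)) => -[y h]; exists y; move: h;
  rewrite mem_rel_conv.
Qed.

(** Rank-nullity for the second projection restricted to [T]: its kernel consists of the pairs (x,
    0), which the first projection maps injectively onto [rel_ker T]. *)
Lemma dim_rel T : (\dim (rel_ker T) + \dim (rel_im T))%N = \dim T.
Proof.
rewrite -(limg_ker_dim (linfun pr2) T); congr (_ + _)%N.
have <- : (linfun pr1 @: (T :&: lker (linfun pr2)))%VS = rel_ker T.
  apply/vspaceP=> x; rewrite mem_rel_ker; apply/memv_imgP/idP.
    case=> -[x' y]; rewrite memv_cap memv_ker !lfunE /= => /andP[h /eqP y0].
    by move: h; rewrite y0 => h ->.
  by move=> h; exists (x, 0); rewrite ?memv_cap ?memv_ker !lfunE ?h /=.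
apply: limg_dim_eq; apply/eqP; rewrite -subv0; apply/subvP=> -[x y].
rewrite !memv_cap !memv_ker !lfunE /= => /andP[/andP[_ /eqP->] /eqP->].
exact: mem0v.
Qed.

Lemma dim_rel_conv T :
  (\dim (rel_ker (rel_conv T)) + \dim (rel_im (rel_conv T)))%N = \dim T.
Proof.
rewrite -(limg_ker_dim (linfun pr1) T); congr (_ + _)%N; last first.
  congr (\dim _); apply/vspaceP=> x; apply/mem_rel_im_conv/memv_imgP.
    by case=> y h; exists (x, y); rewrite ?lfunE.
  by case=> -[x' y] h ->; exists y; rewrite lfunE.
have <- : (linfun pr2 @: (T :&: lker (linfun pr1)))%VS = rel_ker (rel_conv T).
  apply/vspaceP=> x; rewrite mem_rel_ker mem_rel_conv; apply/memv_imgP/idP.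
    case=> -[x' y]; rewrite memv_cap memv_ker !lfunE /= => /andP[h /eqP y0].
    by move: h; rewrite y0 => h ->.
  by move=> h; exists (0, x); rewrite ?memv_cap ?memv_ker !lfunE ?h /=.
apply: limg_dim_eq; apply/eqP; rewrite -subv0; apply/subvP=> -[x y].
rewrite !memv_cap !memv_ker !lfunE /= => /andP[/andP[_ /eqP->] /eqP->].
exact: mem0v.
Qed.

(** Here [T] is the graph of a surjective linear map defined on a subspace of [A], and [W] is the
    preimage of [U]. Cutting [T] down to second components in [U] keeps the kernel and makes the
    image [U]; as the cut relation is still single-valued, its dimension is that of its domain
    [W]. *)
Lemma dim_rel_preim T (U : {vspace B}) (W : {vspace A}) :
    rel_im T = fullv -> rel_ker (rel_conv T) = 0%VS ->
    (forall x, x \in W <-> exists y, (x, y) \in T /\ y \in U) ->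
  \dim W = (\dim (rel_ker T) + \dim U)%N.
Proof.
move=> onto fnl memW; pose S := (T :&: (linfun pr2 @^-1: U))%VS.
have memS x y : ((x, y) \in S) = ((x, y) \in T) && (y \in U).
  by rewrite memv_cap -memv_preim lfunE.
have <- : rel_ker S = rel_ker T.
  by apply/vspaceP=> x; rewrite !mem_rel_ker memS mem0v andbT.
have <- : rel_im S = U.
  apply/vspaceP=> y; apply/mem_rel_im/idP.
    by case=> x; rewrite memS => /andP[].
  move=> yU; have /mem_rel_im[x xyT] : y \in rel_im T by rewrite onto memvf.
  by exists x; rewrite memS xyT.
rewrite dim_rel -dim_rel_conv.
have -> : rel_im (rel_conv S) = W.
  apply/vspaceP=> x; apply/mem_rel_im_conv/idP.
    by case=> y; rewrite memS => /andP[? ?]; apply/memW; exists y.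
  by case/memW=> y [h1 h2]; exists y; rewrite memS h1.
suff -> : rel_ker (rel_conv S) = 0%VS by rewrite dimv0.
apply/eqP; rewrite -subv0 -fnl; apply/subvP=> y.
by rewrite !mem_rel_ker !mem_rel_conv memS => /andP[].
Qed.

End Relations.

(** * Composition of linear relations *)

Section RelationComposition.
Variables (F : fieldType) (A B C : vectType F).

(** A predicate on three given subspaces, because the composite to be recognized is itself the
    behavior of a network. *)
Definition rel_composite (T1 : {vspace A * B}) (T2 : {vspace B * C})
    (T : {vspace A * C}) :=
  forall x z, (x, z) \in T <-> exists y, (x, y) \in T1 /\ (y, z) \in T2.

(** As [T1] is a surjective partial map, the kernel and the domain of [T] are the preimages under
    [T1] of those of [T2], so [dim_rel_preim] counts both. *)
Lemma rel_composite_dims T1 T2 T : rel_composite T1 T2 T ->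
    rel_im T1 = fullv -> rel_ker (rel_conv T1) = 0%VS ->
  [/\ \dim (rel_ker T) = (\dim (rel_ker T1) + \dim (rel_ker T2))%N,
      \dim (rel_im (rel_conv T))
        = (\dim (rel_ker T1) + \dim (rel_im (rel_conv T2)))%N,
      rel_ker (rel_conv T) = rel_ker (rel_conv T2)
    & rel_im T = rel_im T2].
Proof.
move=> cT onto fnl; split.
- apply: dim_rel_preim => // x; rewrite mem_rel_ker cT.
  by split=> -[y [? h]]; exists y; rewrite mem_rel_ker in h *.
- apply: dim_rel_preim => // x; split.
    case/mem_rel_im_conv=> z /cT[y [? ?]]; exists y; split=> //.
    by apply/mem_rel_im_conv; exists z.
  case=> y [? /mem_rel_im_conv[z ?]]; apply/mem_rel_im_conv; exists z.
  by apply/cT; exists y.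
- apply/vspaceP=> z; rewrite !mem_rel_ker !mem_rel_conv; apply/idP/idP.
    case/cT=> y []; rewrite -mem_rel_conv -mem_rel_ker fnl memv0.
    by move=> /eqP->.
  by move=> h; apply/cT; exists 0; split=> //; apply: mem0v.
- apply/vspaceP=> z; apply/mem_rel_im/mem_rel_im.
    by case=> x /cT[y [_ ?]]; exists y.
  case=> y yz; have /mem_rel_im[x xy] : y \in rel_im T1 by rewrite onto memvf.
  by exists x; apply/cT; exists y.
Qed.

End RelationComposition.

(** Lets [rel_composite_dims] be applied from the other end, when it is the converse of the second
    relation that is single-valued and onto. *)
Lemma rel_composite_conv (F : fieldType) (A B C : vectType F)
    (T1 : {vspace A * B}) (T2 : {vspace B * C}) (T : {vspace A * C}) :
  rel_composite T1 T2 T ->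
  rel_composite (rel_conv T2) (rel_conv T1) (rel_conv T).
Proof.
move=> cT z x; rewrite mem_rel_conv cT.
by split=> -[y [h1 h2]]; exists y; move: h1 h2; rewrite !mem_rel_conv.
Qed.

(** * Dimensions of boundary data and of behaviors *)

Lemma dim_fspace (F : fieldType) (P : finType) :
  dim (fspace F P) = #|P|.
Proof. exact: muln1. Qed.

Lemma dim_bdspace (F : fieldType) (P : finType) :
  dim (bdspace F P) = (2 * #|P|)%N.
Proof. by rewrite mul2n -addnn -{1 2}(dim_fspace F P). Qed.

(** [W] is the kernel of the surjection sending (x1, x2) to (x1 o a, x2), from dimension 2|P| onto
    dimension |Q| + |P|. This gives the kernel for type 3, and that of the converse for type 4. *)
Lemma dim_restriction_ker (F : fieldType) (P Q : finType) (a : Q -> P)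
    (W : {vspace bdspace F P}) : injective a ->
    (forall x, x \in W <-> x.2 = 0 /\ forall q, x.1 (a q) = 0) ->
  (\dim W + #|Q|)%N = #|P|.
Proof.
move=> a_inj memW.
pose g (x : bdspace F P) : fspace F Q * fspace F P :=
  ([ffun q => x.1 (a q)], x.2).
have g_lin : linear g.
  move=> c x y; rewrite /g; congr (_, _).
  by apply/ffunP=> q; rewrite !ffunE.
pose L := GRing.isLinear.Build _ _ _ _ _ g_lin.
pose f : {linear _ -> _} := HB.pack g L.
have kerE : (fullv :&: lker (linfun f))%VS = W.
  apply/vspaceP=> x; rewrite memv_cap memvf memv_ker (lfunE f) /=.
  apply/eqP/idP; first last.
    case/memW=> x2 x1; rewrite /g x2; congr (_, _).
    by apply/ffunP=> q; rewrite !ffunE x1.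
  case=> /ffunP x1 x2; apply/memW; split=> // q.
  by have := x1 q; rewrite !ffunE.
have imE : (linfun f @: fullv)%VS = fullv.
  apply/vspaceP=> -[y1 y2]; rewrite memvf; apply/memv_imgP.
  (* Extend [y1] by zero outside the image of [a]. *)
  exists ([ffun p => if [pick q | a q == p] is Some q then y1 q else 0], y2).
    exact: memvf.
  rewrite (lfunE f) /= /g; congr (_, _); apply/ffunP=> q; rewrite !ffunE.
  by case: pickP => [q' /eqP/a_inj->|/(_ q)]; rewrite ?eqxx.
have := limg_ker_dim (linfun f) fullv; rewrite kerE imE !dimvf dim_bdspace.
have -> : dim (fspace F Q * fspace F P)%type = (#|Q| + #|P|)%N.
  by rewrite -(dim_fspace F Q) -(dim_fspace F P).
rewrite mul2n -addnn addnA; apply: addIn.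
Qed.

Section BehaviorDimension.
Variables (F : fieldType) (P Q : finType) (N : ionet F P Q).

(** The solution space has |V| + 2|P| + 2|Q| unknowns and |P| + |Q| + |V| equations. When every
    vertex is an input or an output, the boundary data determine the potential, so projecting to
    them loses no dimension. *)
Lemma behavior_dim_ge : inputs N :|: outputs N = [set: _] ->
  (#|P| + #|Q| <= \dim (behavior N))%N.
Proof.
move=> ioT.
pose L := GRing.isLinear.Build _ _ _ _ _ (@behavior_defect_linear F P Q N).
pose f : {linear _ -> _} := HB.pack (@behavior_defect F P Q N) L.
pose s : {linear (fspace F (vertex N) * (bdspace F P * bdspace F Q))%type -> _} :=
  snd.
have -> : \dim (behavior N) = \dim (lker (linfun f)).
  rewrite /behavior; apply: limg_dim_eq; apply/eqP; rewrite -subv0.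
  apply/subvP=> -[u [x y]]; rewrite memv_cap !memv_ker (lfunE f) (lfunE s) /=.
  case/andP=> /eqP[/ffunP hx /ffunP hy _] /eqP[x0 y0]; rewrite memv0 x0 y0.
  suff -> : u = 0 by [].
  apply/ffunP=> v; rewrite ffunE; have := in_setT v; rewrite -ioT inE.
  case/orP=> /imsetP[p _ ->]; [move: (hx p)|move: (hy p)].
    by rewrite !ffunE x0 ffunE subr0.
  by rewrite !ffunE y0 ffunE subr0.
have := limg_ker_dim (linfun f) fullv; rewrite capfv dimvf.
have := dimvS (subvf (linfun f @: fullv)%VS); rewrite dimvf.
set W1 := dim _; set W2 := dim _.
have -> : W1 = (#|P| + #|Q| + #|vertex N|)%N.
  by rewrite -!(dim_fspace F).
have -> : W2 = (#|vertex N| + (2 * #|P| + 2 * #|Q|))%N.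
  by rewrite -!(dim_bdspace F) -(dim_fspace F).
by lia.
Qed.

End BehaviorDimension.

(** * Behaviors of composite networks *)

Lemma sum_fibers (V : nmodType) (I J : finType) (A : pred J) (f : I -> J)
    (h : I -> V) :
  \sum_(j | A j) \sum_(i | f i == j) h i = \sum_(i | A (f i)) h i.
Proof.
rewrite [RHS](partition_big f A) //; apply: eq_bigr => j Aj.
apply: eq_bigl => i; rewrite andbC; case: eqP => //= ->.
by rewrite Aj.
Qed.

Section Composition.
Variables (F : fieldType) (P Q R : finType).
Variables (N1 : ionet F P Q) (N2 : ionet F Q R).

Let V := vertex (ionet_comp N1 N2).

Definition comp_inl (a : vertex N1) : V := \pi_(comp_vertex N1 N2) (inl a).
Definition comp_inr (b : vertex N2) : V := \pi_(comp_vertex N1 N2) (inr b).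

Lemma comp_inl_eq a a' : (comp_inl a == comp_inl a') = (a == a').
Proof. exact/eqP/(eqmodP (glue_equiv N1 N2) (inl a) (inl a')). Qed.

Lemma comp_inr_eq b b' : (comp_inr b == comp_inr b') = (b == b').
Proof. exact/eqP/(eqmodP (glue_equiv N1 N2) (inr b) (inr b')). Qed.

Lemma comp_inlr_eqP a b :
  reflect (exists2 q, outp N1 q = a & inp N2 q = b) (comp_inl a == comp_inr b).
Proof.
apply: (iffP eqP) => [/(eqmodP (glue_equiv N1 N2) (inl a) (inr b))|[q <- <-]].
  by case/existsP=> q /andP[/eqP ? /eqP ?]; exists q.
apply/(eqmodP (glue_equiv N1 N2) (inl _) (inr _))/existsP.
by exists q; rewrite !eqxx.
Qed.

Lemma comp_glue q : comp_inl (outp N1 q) = comp_inr (inp N2 q).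
Proof. by apply/eqP/comp_inlr_eqP; exists q. Qed.

Lemma comp_vertex_repr (v : V) :
  v = match repr (v : comp_vertex N1 N2) with
      | inl a => comp_inl a
      | inr b => comp_inr b
      end.
Proof. by rewrite -[LHS](@reprK _ (comp_vertex N1 N2)); case: (repr _). Qed.

(** Gluing identifies vertices only: the edges stay a disjoint union, and each sum on the right has
    at most one term. *)
Lemma comp_laplacian (u : fspace F V) v :
  laplacian (N := ionet_comp N1 N2) u v
  = \sum_(a | comp_inl a == v) laplacian (N := N1) [ffun a => u (comp_inl a)] a
    + \sum_(b | comp_inr b == v) laplacian (N := N2) [ffun b => u (comp_inr b)] b.
Proof.
rewrite /laplacian !sum_fibers big_sumType /=.
by congr (_ + _); apply: eq_bigr => e _; rewrite !ffunE.
Qed.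

Lemma comp_net_current x z v :
  net_current (N := ionet_comp N1 N2) x z v
  = \sum_(b | comp_inr b == v) \sum_(r | outp N2 r == b) z.2 r
    - \sum_(a | comp_inl a == v) \sum_(p | inp N1 p == a) x.2 p.
Proof. by rewrite /net_current !sum_fibers. Qed.

(** Potentials that agree on the interface glue together, and the interface current leaving [N1]
    cancels the one entering [N2]. Conversely, restricting a global potential leaves just one
    possible interface current, the one prescribed by the equations of [N1]. *)
Lemma behavior_comp :
  rel_composite (behavior N1) (behavior N2) (behavior (ionet_comp N1 N2)).
Proof.
move=> x z; rewrite mem_behavior; split; last first.
  case=> y [/mem_behavior[u1 [ux1 uy1 lap1]] /mem_behavior[u2 [uy2 uz2 lap2]]].
  pose u : fspace F V :=
    [ffun v => match repr (v : comp_vertex N1 N2) with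
               | inl a => u1 a
               | inr b => u2 b
               end].
  have uglue (q : Q) : u1 (outp N1 q) = u2 (inp N2 q) by rewrite uy1 uy2.
  (* The chosen representative of a glued vertex may lie on either side; [uglue] makes the two
     readings agree. *)
  have ul a : u (comp_inl a) = u1 a.
    have /eqP := comp_vertex_repr (comp_inl a); rewrite ffunE.
    case: (repr _) => [a'|b]; first by rewrite comp_inl_eq => /eqP->.
    by case/comp_inlr_eqP=> q <- <-.
  have ur b : u (comp_inr b) = u2 b.
    have /eqP := comp_vertex_repr (comp_inr b); rewrite ffunE.
    case: (repr _) => [a|b']; last by rewrite comp_inr_eq => /eqP->.
    by rewrite eq_sym => /comp_inlr_eqP[q <- <-].
  exists u; split=> [p|r|v]; first by rewrite -ux1 -ul.
    by rewrite -uz2 -ur.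
  rewrite comp_laplacian comp_net_current.
  have -> : [ffun a => u (comp_inl a)] = u1 by apply/ffunP=> a; rewrite ffunE.
  have -> : [ffun b => u (comp_inr b)] = u2 by apply/ffunP=> a; rewrite ffunE.
  rewrite (eq_bigr _ (fun a _ => lap1 a)) (eq_bigr _ (fun b _ => lap2 b)).
  rewrite /net_current !sumrB !sum_fibers.
  (* Both interface sums now range over the same glued vertices and cancel. *)
  under [X in X - _ + _]eq_bigl => q do rewrite comp_glue.
  by rewrite addrC addrA subrK.
case=> u [ux uz lap].
pose u1 : fspace F _ := [ffun a => u (comp_inl a)].
pose u2 : fspace F _ := [ffun b => u (comp_inr b)].
pose y1 : fspace F Q := [ffun q => u1 (outp N1 q)].
(* The equation of [N1] at [outp N1 q], solved for the outgoing current. *)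
pose y2 : fspace F Q :=
  [ffun q => laplacian u1 (outp N1 q) + \sum_(p | inp N1 p == outp N1 q) x.2 p].
have eqS1 (G : vertex N1 -> F) a : \sum_(a' | comp_inl a' == comp_inl a) G a'
    = G a.
  by rewrite (eq_bigl _ _ (fun a' => comp_inl_eq a' a)) big_pred1_eq.
have eqS2 (G : vertex N2 -> F) b : \sum_(b' | comp_inr b' == comp_inr b) G b'
    = G b.
  by rewrite (eq_bigl _ _ (fun b' => comp_inr_eq b' b)) big_pred1_eq.
exists (y1, y2); split; apply/mem_behavior.
  exists u1; split=> [p|q|a]; [by rewrite -ux ffunE|by rewrite /= !ffunE|].
  case: (pickP (fun q => outp N1 q == a)) => [q /eqP<-|noq].
    rewrite /net_current (eq_bigl (pred1 q)) ?big_pred1_eq /= ?ffunE ?addrK //.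
    by move=> q' /=; apply/eqP/eqP=> [/outp_inj|->].
  (* A vertex of [N1] that is no output is not glued, so the composite has the same equation there
     as [N1]. *)
  have nor b : (comp_inr b == comp_inl a) = false.
    by apply/negP; rewrite eq_sym => /comp_inlr_eqP[q /eqP]; rewrite noq.
  have := lap (comp_inl a); rewrite comp_laplacian comp_net_current !eqS1.
  by rewrite /net_current !(big_pred0 _ _ _ _ nor) (big_pred0 _ _ _ _ noq) addr0.
exists u2; split=> [q|r|b]; [by rewrite /= !ffunE comp_glue|by rewrite -uz ffunE|].
have := lap (comp_inr b); rewrite comp_laplacian comp_net_current !eqS2.
rewrite [net_current _ _ b]/net_current.
case: (pickP (fun q => inp N2 q == b)) => [q /eqP<-|noq].
  rewrite -comp_glue !eqS1 (eq_bigl (pred1 q) (fun q' => y2 q')) ?big_pred1_eq;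
    last first.
    by move=> q' /=; apply/eqP/eqP=> [/inp_inj|->].
  by rewrite ffunE => h; rewrite opprD addrCA -h addKr.
have nol a : (comp_inl a == comp_inr b) = false.
  by apply/negP=> /comp_inlr_eqP[q _ /eqP]; rewrite noq.
by rewrite !(big_pred0 _ _ _ _ nol) (big_pred0 _ _ _ _ noq) add0r.
Qed.

End Composition.
Arguments comp_inl {F P Q R N1 N2} a.
Arguments comp_inr {F P Q R N1 N2} b.

(** * Disjoint paths and vertex cuts *)

Section Linkages.
Variables (F : fieldType) (P Q : finType) (N : ionet F P Q).

Definition trail (G : mgraph) (v : vertex G) (es : seq (oedge G)) :=
  v :: map ehead es.

(** A connection as an indexed family with recorded end labels, so that families can be reindexed
    and concatenated across an interface. *)
Definition linkage (I : finType) (a : I -> P) (b : I -> Q) : Prop :=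
  exists es : I -> seq (oedge N),
  [/\ forall i, walk (inp N (a i)) (es i) && uniq (trail (inp N (a i)) (es i)),
      forall i, last (inp N (a i)) (map ehead (es i)) = outp N (b i),
      forall i p, inp N p \in trail (inp N (a i)) (es i) -> p = a i,
      forall i q, outp N q \in trail (inp N (a i)) (es i) -> q = b i
    & forall i j v, v \in trail (inp N (a i)) (es i) ->
        v \in trail (inp N (a j)) (es j) -> i = j].

(* A walk from an input to an output starts in [Z] or enters it; either way it
   meets [K] there. *)
Definition vertex_cut (Z K : {set vertex N}) : Prop :=
  [/\ outputs N \subset Z, inputs N :&: Z \subset K
    & forall e : oedge N, etail e \notin Z -> ehead e \in Z -> ehead e \in K].

Lemma linkage_inj (I : finType) (a : I -> P) (b : I -> Q) :
  linkage a b -> injective a /\ injective b.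
Proof.
case=> es [_ l _ _ dis]; split=> i j ij.
  by apply: (dis _ _ (inp N (a i))); rewrite ?ij mem_head.
by apply: (dis _ _ (outp N (b i))); [rewrite -l|rewrite ij -l]; apply: mem_last.
Qed.

Lemma linkage_reindex (I J : finType) (a : I -> P) (b : I -> Q) (h : J -> I)
    (a' : J -> P) (b' : J -> Q) :
    injective h -> a \o h =1 a' -> b \o h =1 b' ->
  linkage a b -> linkage a' b'.
Proof.
move=> h_inj ha hb [es [wu l ins outs dis]].
exists (es \o h); split=> [i|i|i|i|i j v] /=; rewrite -?ha -?hb.
- exact: wu.
- exact: l.
- exact: ins.
- exact: outs.
- by move=> vi vj; apply/h_inj/(dis _ _ v).
Qed.

Lemma linkage_trivial (I : finType) (a : I -> P) (b : I -> Q) :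
  injective a -> (forall i, inp N (a i) = outp N (b i)) -> linkage a b.
Proof.
move=> a_inj ab; exists (fun _ => [::]); split=> //= i.
- by move=> p; rewrite inE => /eqP/inp_inj.
- by move=> q; rewrite inE ab => /eqP/outp_inj.
- by move=> j v; rewrite !inE => /eqP-> /eqP/inp_inj/a_inj.
Qed.

Lemma linkage_mconn (I : finType) (a : I -> P) (b : I -> Q) :
  linkage a b -> (#|I| <= mconn N)%N.
Proof.
case=> es [wu l ins outs dis].
have size_es i : (size (es i) <= #|vertex N|)%N.
  have /andP[_ /card_uniqP] := wu i; rewrite /= size_map => sz.
  by apply: ltnW; rewrite -sz max_card.
pose path i : gpath N := (inp N (a i), Bseq (size_es i)).
have path_inj : injective path.
  move=> i j [/inp_inj aij _]; apply: (dis _ _ (inp N (a i))).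
    exact: mem_head.
  by rewrite aij mem_head.
rewrite -(card_imset predT path_inj).
apply: (bigmax_sup [set path i | i in predT]) => //.
apply/andP; split.
  apply/forallP=> c; apply/implyP=> /imsetP[i _ ->].
  rewrite /is_path /joins [X in X && _]wu /= imset_f //= /path_tail /= l imset_f //=.
  have /andP[_ /=/andP[h1 _]] := wu i.
  apply/andP; split.
    (* An input met later on the trail would be its start again, which [uniq] forbids. *)
    apply/allP=> v vt /=; apply/negP=> /imsetP[p _ vE]; subst v.
    move: h1; have <- := ins i p _; first by rewrite vt.
    by rewrite in_cons vt orbT.
  apply/allP=> v vt /=; apply/negP=> /imsetP[q _ vE]; subst v.
  have /andP[_] := wu i; rewrite /trail lastI rcons_uniq l.
  have <- := outs i q _; first by rewrite vt.
  by rewrite /trail lastI mem_rcons in_cons vt orbT.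
apply/forallP=> c; apply/implyP=> /imsetP[i _ ->].
apply/forallP=> d; apply/implyP=> /imsetP[j _ ->]; apply/implyP=> nij.
apply/pred0P=> v /=; apply/negP=> /andP[vi vj]; case/eqP: nij.
by congr path; apply: dis vi vj.
Qed.

Lemma walk_cut Z K v es : vertex_cut Z K -> walk v es -> v \in inputs N ->
  last v (map ehead es) \in outputs N -> exists2 w, w \in K & w \in trail v es.
Proof.
case=> /subsetP oZ /subsetP iZ eZ wk vin lst.
have: v \in Z \/ v \notin Z by case: (v \in Z); [left|right].
case=> [vZ|].
  by exists v; rewrite ?mem_head // iZ // inE vin.
elim: es v wk lst {vin} => [|e es IH] v /= wk lst vZ; first by rewrite oZ in vZ.
case/andP: wk => /eqP te wk; case: (boolP (ehead e \in Z)) => [hZ|hZ].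
  exists (ehead e); last by rewrite !inE eqxx orbT.
  by apply: eZ; rewrite ?te.
have [w wK wt] := IH _ wk lst hZ; exists w => //.
by rewrite inE wt orbT.
Qed.

(** The easy half of Menger's theorem: every path of a connection meets [K], and disjoint paths meet
    it in different vertices. *)
Lemma mconn_cut Z K : vertex_cut Z K -> (mconn N <= #|K|)%N.
Proof.
move=> cut; apply/bigmax_leqP=> C /andP[/forallP paths /forallP dis].
(* For [c] in [C] the default [c.1] is never taken, by [walk_cut]. *)
pose f (c : gpath N) := odflt c.1 [pick w in K | w \in path_vertices c].
have fP c : c \in C -> f c \in K /\ f c \in path_vertices c.
  move=> cC; have := paths c; rewrite cC /= => /andP[/andP[wk _]].
  case/and4P=> h1 _ h2 _; rewrite /f; case: pickP => [w /andP[]//|no].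
  have [w wK wt] := walk_cut cut wk h1 h2.
  by have := no w; rewrite wK (wt : w \in path_vertices c).
rewrite -(@card_in_imset _ _ f).
  by apply/subset_leq_card/subsetP=> w /imsetP[c /fP[? _] ->].
move=> c d cC dC fE; apply/eqP; apply: contraT => cd.
have := dis c; rewrite cC => /forallP/(_ d); rewrite dC cd /=.
move=> /pred0P/(_ (f c)) /=.
by rewrite (fP c cC).2 fE (fP d dC).2.
Qed.

End Linkages.

Section Good.
Variables (F : fieldType).

(** The linkage bounds [mconn] from below and the cut bounds it from above. Dimensions are stated
    additively, which avoids truncated subtraction. *)
Definition good P Q (N : ionet F P Q) (k : nat) : Prop :=
  [/\ (\dim (rel_ker (behavior N)) + k)%N = #|P|
      /\ \dim (rel_im (rel_conv (behavior N))) = (#|P| + k)%N,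
      (\dim (rel_ker (rel_conv (behavior N))) + k)%N = #|Q|
      /\ \dim (rel_im (behavior N)) = (#|Q| + k)%N,
      exists (I : finType) (a : I -> P) (b : I -> Q), #|I| = k /\ linkage N a b
    & exists Z K : {set vertex N}, vertex_cut Z K /\ (#|K| <= k)%N].

Lemma good_mconn P Q (N : ionet F P Q) k : good N k -> mconn N = k.
Proof.
case=> _ _ [I [a [b [<- lk]]]] [Z [K [cut Kk]]].
by apply/eqP; rewrite eqn_leq (leq_trans (mconn_cut cut) Kk) (linkage_mconn lk).
Qed.

End Good.

(** * Linkages and cuts in composite networks *)

Section Composition.
Variables (F : fieldType) (P Q R : finType).
Variables (N1 : ionet F P Q) (N2 : ionet F Q R).
Local Notation N := (ionet_comp N1 N2).

Let el (e : oedge N1) : oedge N := inl e.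
Let er (e : oedge N2) : oedge N := inr e.

Lemma walk_inl a es :
  walk (G := N) (comp_inl a) (map el es) = walk a es.
Proof. by elim: es a => //= e es IH a; rewrite -IH -(comp_inl_eq N2). Qed.

Lemma walk_inr b es :
  walk (G := N) (comp_inr b) (map er es) = walk b es.
Proof. by elim: es b => //= e es IH b; rewrite -IH -(comp_inr_eq N1). Qed.

Lemma walk_cat (G : mgraph) (v : vertex G) es es' :
  walk v (es ++ es') = walk v es && walk (last v (map ehead es)) es'.
Proof. by elim: es v => //= e es IH v; rewrite IH andbA. Qed.

Lemma map_ehead_inl es :
  map ehead (map el es) = map comp_inl (map ehead es).
Proof. by rewrite -!map_comp. Qed.

Lemma map_ehead_inr es :
  map ehead (map er es) = map comp_inr (map ehead es).
Proof. by rewrite -!map_comp. Qed.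

(** Concatenate trails with the same index: the first ends at output [b i], which is glued to the
    input where the second starts. *)
Lemma linkage_comp (I : finType) (a : I -> P) (b : I -> Q) (c : I -> R) :
  linkage N1 a b -> linkage N2 b c -> linkage N a c.
Proof.
case=> es1 [wu1 l1 ins1 outs1 dis1] [es2 [wu2 l2 ins2 outs2 dis2]].
pose es i := map el (es1 i) ++ map er (es2 i).
have outp_b i : outp N1 (b i) \in trail (inp N1 (a i)) (es1 i).
  by rewrite -l1 mem_last.
have inp_b i : inp N2 (b i) \in trail (inp N2 (b i)) (es2 i) by apply: mem_head.
(* A trail in [N1] has [b i] as its only output and a trail in [N2] has [b j] as its only input, so
   the two can meet only at the junction, and only if their indices agree. *)
have cross i j x y : x \in trail (inp N1 (a i)) (es1 i) ->
    y \in trail (inp N2 (b j)) (es2 j) -> comp_inl x = comp_inr y ->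
    i = j /\ y = inp N2 (b i).
  move=> xi yj /eqP/comp_inlr_eqP[q xE yE]; subst x y.
  have qb := outs1 _ _ xi; subst q; split=> //.
  by apply: (dis1 _ _ _ xi); rewrite (ins2 _ _ yj) outp_b.
have trailE i : trail (inp N (a i)) (es i) =
    map comp_inl (trail (inp N1 (a i)) (es1 i))
    ++ map comp_inr (map ehead (es2 i)).
  by rewrite /trail map_cat map_ehead_inl map_ehead_inr.
have mem_trail i v : v \in trail (inp N (a i)) (es i) ->
    (exists2 x, x \in trail (inp N1 (a i)) (es1 i) & v = comp_inl x) \/
    (exists2 y, y \in trail (inp N2 (b i)) (es2 i) & v = comp_inr y).
  rewrite trailE mem_cat => /orP[/mapP|/mapP[y yt ->]]; first by left.
  by right; exists y; rewrite // /trail inE yt orbT.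
have last1 i : last (inp N (a i)) (map ehead (map el (es1 i)))
    = comp_inr (inp N2 (b i)).
  by rewrite map_ehead_inl (last_map comp_inl) l1 comp_glue.
exists es; split=> [i|i|i p|i r|i j v].
- have /andP[w1 u1] := wu1 i; have /andP[w2 u2] := wu2 i.
  rewrite walk_cat walk_inl w1 last1 walk_inr w2 !andTb.
  rewrite trailE cat_uniq.
  rewrite map_inj_uniq; last by move=> x x' /eqP; rewrite comp_inl_eq => /eqP.
  rewrite map_inj_uniq; last by move=> x x' /eqP; rewrite comp_inr_eq => /eqP.
  rewrite u1; move: u2; rewrite {1}/trail cons_uniq => /andP[nb ->]; rewrite andTb andbT.
  apply/hasPn=> v /mapP[y yt ->].
  apply/negP=> /mapP[x xt /esym xy]; case/negP: nb.
  have [|_ <-//] := cross _ i _ _ xt _ xy.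
  by rewrite /trail inE yt orbT.
- by rewrite map_cat last_cat last1 map_ehead_inr (last_map comp_inr) l2.
- case/mem_trail=> [[x xt /eqP]|[y yt /eqP]].
    by rewrite (comp_inl_eq N2) => /eqP xE; apply: ins1; rewrite xE.
  case/comp_inlr_eqP=> q pq yE; subst y.
  by apply: ins1; rewrite -pq (ins2 _ _ yt) outp_b.
- case/mem_trail=> [[x xt /eqP]|[y yt /eqP]]; last first.
    by rewrite (comp_inr_eq N1) => /eqP yE; apply: outs2; rewrite yE.
  rewrite eq_sym => /comp_inlr_eqP[q xE rE]; subst x.
  by apply: outs2; rewrite -rE (outs1 _ _ xt) inp_b.
- case/mem_trail=> [[x xt ->]|[y yt ->]] /mem_trail[[x' xt' /eqP]|[y' yt' /eqP]].
  + by rewrite comp_inl_eq => /eqP xx'; apply: dis1 xt _; rewrite xx'.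
  + by move/eqP/(cross _ _ _ _ xt yt')=> [].
  + by move/eqP/esym/(cross _ _ _ _ xt' yt)=> [].
  + by rewrite comp_inr_eq => /eqP yy'; apply: dis2 yt _; rewrite yy'.
Qed.

(** An edge of [N1] can reach the image of [Z] only at a glued vertex; that vertex is an input of
    [N2] lying in [Z], hence in [K]. *)
Lemma vertex_cut_comp (Z K : {set vertex N2}) : vertex_cut Z K ->
  vertex_cut (N := N) [set comp_inr b | b in Z] [set comp_inr b | b in K].
Proof.
case=> /subsetP oZ /subsetP iZ eZ; split.
- by apply/subsetP=> v /imsetP[r _ ->]; apply/imset_f/oZ/imset_f.
- apply/subsetP=> v; rewrite inE => /andP[/imsetP[p _ ->] /imsetP[b bZ bE]].
  rewrite bE; apply/imset_f/iZ; rewrite inE bZ andbT.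
  by move/eqP/comp_inlr_eqP: bE => [q _ <-]; apply: imset_f.
- case=> e /= te /imsetP[b bZ bE]; rewrite bE; apply: imset_f.
    apply: iZ; rewrite inE bZ andbT.
    by move/eqP/comp_inlr_eqP: bE => [q _ <-]; apply: imset_f.
  move/eqP: bE; rewrite [_ == _]comp_inr_eq => /eqP bE; rewrite -bE in bZ *.
  apply: eZ bZ; apply: contra te => te.
  exact: imset_f.
Qed.

End Composition.

(** * Goodness under composition and isomorphism *)

Section Good.
Variable F : fieldType.

Lemma vertex_cut_inputs P Q (N : ionet F P Q) :
  vertex_cut (N := N) setT (inputs N) /\ (#|inputs N| <= #|P|)%N.
Proof.
split; last exact: leq_imset_card.
by split=> [||e]; rewrite ?subsetT ?setIT ?inE.
Qed.

(** Goodness of [N1] for |R| makes its behavior single-valued and onto, and its linkage reaches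
    every label in [R]. So each path of [N2] can be prolonged backwards, and a cut of [N2] still
    works. *)
Lemma good_comp_reduction P Q R (N1 : ionet F P R) (N2 : ionet F R Q) k :
  good N1 #|R| -> good N2 k -> good (ionet_comp N1 N2) k.
Proof.
case=> [[dk1 _] [dkc1 di1] [I1 [a1 [b1 [cI1 lk1]]]] _].
case=> [[dk2 dic2] [dkc2 di2] [I2 [a2 [b2 [cI2 lk2]]]] [Z [K [cut cK]]]].
have onto : rel_im (behavior N1) = fullv.
  by apply/eqP; rewrite eqEdim subvf /= di1 dimvf dim_bdspace; lia.
have fnl : rel_ker (rel_conv (behavior N1)) = 0%VS.
  by apply/eqP; rewrite -dimv_eq0; lia.
have [k1 k2 k3 k4] := rel_composite_dims (behavior_comp N1 N2) onto fnl.
split.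
- by rewrite k1 k2 dic2; lia.
- by rewrite k3 k4.
- have [_ b1_inj] := linkage_inj lk1; have [a2_inj _] := linkage_inj lk2.
  (* An injection between sets of equal size; its inverse [h] finds the [N1] path that arrives at a
     given label. *)
  have [|h _ hK] := inj_card_bij b1_inj; first by rewrite cI1.
  exists I2, (a1 \o h \o a2), b2; split=> //; apply: linkage_comp lk2.
  apply: (linkage_reindex (h := h \o a2)) lk1 => //= [|i] /=; last exact: hK.
  exact: inj_comp (can_inj hK) a2_inj.
- exists [set comp_inr b | b in Z], [set comp_inr b | b in K].
  by split; [exact: vertex_cut_comp|exact: leq_trans (leq_imset_card _ _) cK].
Qed.

(** The mirror image: conversely composed, [N2] comes first, and every path of [N1] can be prolonged
    forwards. All inputs together serve as the cut. *)
Lemma good_comp_extension P Q R (N1 : ionet F P R) (N2 : ionet F R Q) :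
  good N1 #|P| -> good N2 #|R| -> good (ionet_comp N1 N2) #|P|.
Proof.
case=> [[dk1 dic1] [dkc1 di1] [I1 [a1 [b1 [cI1 lk1]]]] _].
case=> [[dk2 dic2] [dkc2 di2] [I2 [a2 [b2 [cI2 lk2]]]] _].
have onto : rel_im (rel_conv (behavior N2)) = fullv.
  by apply/eqP; rewrite eqEdim subvf /= dic2 dimvf dim_bdspace; lia.
have fnl : rel_ker (rel_conv (rel_conv (behavior N2))) = 0%VS.
  by apply/eqP; rewrite rel_convK -dimv_eq0; lia.
have cC := rel_composite_conv (behavior_comp N1 N2).
have [] := rel_composite_dims cC onto fnl; rewrite !rel_convK => k1 k2 k3 k4.
split.
- by rewrite k3 k4.
- by rewrite k1 k2 di1; lia.
- have [_ b1_inj] := linkage_inj lk1; have [a2_inj _] := linkage_inj lk2.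
  have [|h _ hK] := inj_card_bij a2_inj; first by rewrite cI2.
  exists I1, a1, (b2 \o h \o b1); split=> //; apply: linkage_comp lk1 _.
  apply: (linkage_reindex (h := h \o b1)) lk2 => //= [|i] /=; last exact: hK.
  exact: inj_comp (can_inj hK) b1_inj.
- by exists setT, (inputs _); apply: vertex_cut_inputs.
Qed.

Lemma ionet_iso_sym P Q (N N' : ionet F P Q) : ionet_iso N N' -> ionet_iso N' N.
Proof.
case=> f [g [[f' fK f'K] [g' gK g'K] [hd rv] w [ip op]]].
exists f', g'; split.
- by exists f.
- by exists g.
- by split=> e; [rewrite -[in RHS](g'K e) hd fK|rewrite -[in LHS](g'K e) -rv gK].
- by move=> e; rewrite -[in RHS](g'K e) w.
- by split=> p; rewrite -?ip -?op fK.
Qed.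

Lemma behavior_iso P Q (N N' : ionet F P Q) x y :
  ionet_iso N N' -> behavior_rel N x y -> behavior_rel N' x y.
Proof.
case=> f [g [[f' fK f'K] g_bij [hd rv] w [ip op]]] [u [ux uy lap]].
exists [ffun v => u (f' v)]; split=> [p|q|v]; try by rewrite ffunE -?ip -?op fK.
have <- : net_current (N := N) x y (f' v) = net_current (N := N') x y v.
  by congr (_ - _); apply: eq_bigl => p; rewrite -?ip -?op -(can_eq fK) f'K.
rewrite -lap /laplacian (reindex g) /=; last exact: onW_bij.
apply: eq_big => [e|e _]; first by rewrite hd -(can_eq f'K) fK.
by rewrite w !ffunE /etail -rv !hd !fK.
Qed.

Lemma behavior_iso_eq P Q (N N' : ionet F P Q) :
  ionet_iso N N' -> behavior N = behavior N'.
Proof.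
move=> NN'; apply/vspaceP=> -[x y].
by apply/idP/idP=> /mem_behavior h; apply/mem_behavior; apply: behavior_iso h => //;
  apply: ionet_iso_sym.
Qed.

Lemma linkage_iso P Q (N N' : ionet F P Q) (I : finType) (a : I -> P) (b : I -> Q) :
  ionet_iso N N' -> linkage N a b -> linkage N' a b.
Proof.
case=> f [g [[f' fK f'K] g_bij [hd rv] w [ip op]]].
case=> es [wu l ins outs dis]; exists (fun i => map g (es i)).
have trailE i : trail (inp N' (a i)) (map g (es i)) = map f (trail (inp N (a i)) (es i)).
  rewrite /trail /= ip; congr (_ :: _); rewrite -!map_comp.
  by apply: eq_map => e /=; rewrite hd.
have f_inj := can_inj fK.
have walkE v s : walk (f v) (map g s) = walk v s.
  elim: s v => //= e s IH v; rewrite -IH hd; congr (_ && _).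
  by rewrite /etail -rv hd (inj_eq f_inj).
split=> [i|i|i p|i q|i j v].
- by rewrite trailE map_inj_uniq // -ip walkE.
- have /= := congr1 (last (inp N' (a i))) (trailE i); rewrite ip => ->.
  by rewrite -ip last_map l op.
- by rewrite trailE -ip mem_map //; apply: ins.
- by rewrite trailE -op mem_map //; apply: outs.
- by rewrite !trailE => /mapP[x xi ->]; rewrite mem_map //; apply: dis.
Qed.

Lemma vertex_cut_iso P Q (N N' : ionet F P Q) (Z K : {set vertex N}) :
    ionet_iso N N' -> vertex_cut Z K ->
  exists Z' K' : {set vertex N'}, vertex_cut Z' K' /\ (#|K'| <= #|K|)%N.
Proof.
move/ionet_iso_sym=> [f [g [f_bij g_bij [hd rv] w [ip op]]]].
case=> /subsetP oZ /subsetP iZ eZ; exists (f @^-1: Z), (f @^-1: K); split.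
  split.
  - by apply/subsetP=> _ /imsetP[q _ ->]; rewrite inE op; apply/oZ/imset_f.
  - apply/subsetP=> v; rewrite !inE => /andP[/imsetP[p _ ->]]; rewrite ip => pZ.
    by apply: iZ; rewrite inE pZ imset_f.
  - move=> e; rewrite !inE => te he; rewrite -hd; apply: eZ; rewrite ?hd //.
    by rewrite /etail -rv hd.
by rewrite on_card_preimset //; apply: onW_bij.
Qed.

Lemma good_iso P Q (N N' : ionet F P Q) k : ionet_iso N N' -> good N k -> good N' k.
Proof.
move=> iso [d1 d2 [I [a [b [cI lk]]]] [Z [K [cut cK]]]].
rewrite /good -(behavior_iso_eq iso); split=> //.
  by exists I, a, b; split=> //; apply: linkage_iso iso lk.
have [Z' [K' [cut' cK']]] := vertex_cut_iso iso cut.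
by exists Z', K'; split=> //; apply: leq_trans cK' cK.
Qed.

End Good.

(** * Goodness of the elementary networks *)

Section Elementary.
Variables (F : fieldType) (P Q : finType) (N : ionet F P Q).
Local Notation net_current := (net_current (N := N)).
Implicit Types (x : bdspace F P) (y : bdspace F Q) (u : fspace F (vertex N)).

Lemma net_current_inp x p : net_current x 0 (inp N p) = - x.2 p.
Proof.
rewrite /Defs.net_current big1 => [|q _]; last by rewrite ffunE.
rewrite add0r (eq_bigl (pred1 p)) ?big_pred1_eq // => p' /=.
by rewrite (inj_eq (@inp_inj _ _ _ N)).
Qed.

Lemma net_current_outp y q : net_current 0 y (outp N q) = y.2 q.
Proof.
rewrite /Defs.net_current [X in _ - X]big1 => [|p _];
  last by rewrite ffunE.
rewrite subr0 (eq_bigl (pred1 q)) ?big_pred1_eq // => q' /=.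
by rewrite (inj_eq (@outp_inj _ _ _ N)).
Qed.

Lemma net_current_notin_inputs x v :
  v \notin inputs N -> net_current x 0 v = 0.
Proof.
move=> vI; rewrite /Defs.net_current big1 => [|q _]; last by rewrite ffunE.
rewrite big_pred0 ?subr0 // => p; apply/eqP=> pv.
by rewrite -pv imset_f in vI.
Qed.

Lemma net_current_notin_outputs y v :
  v \notin outputs N -> net_current 0 y v = 0.
Proof.
move=> vO; rewrite /Defs.net_current [X in _ - X]big1 => [|p _];
  last by rewrite ffunE.
rewrite big_pred0 ?subr0 // => q; apply/eqP=> qv.
by rewrite -qv imset_f in vO.
Qed.

Lemma laplacian0 v : laplacian (0 : fspace F (vertex N)) v = 0.
Proof. by rewrite /laplacian big1 // => e _; rewrite !ffunE subr0 mulr0. Qed.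

(** A kernel element comes from a potential that vanishes on the outputs and is harmonic off the
    inputs. Once this potential is zero, so are the input potentials and, through the Laplacian, the
    input currents. *)
Lemma rel_ker_behavior0 :
    (forall u, (forall q, u (outp N q) = 0) ->
      (forall v, v \notin inputs N -> laplacian u v = 0) -> u = 0) ->
  rel_ker (behavior N) = 0%VS.
Proof.
move=> uniq0; apply/eqP; rewrite -subv0; apply/subvP=> -[x1 x2].
rewrite mem_rel_ker => /mem_behavior[u [ux uy lap]].
have u0 : u = 0.
  apply: uniq0 => [q|v vI]; first by rewrite uy ffunE.
  by rewrite lap net_current_notin_inputs.
rewrite memv0; apply/eqP; congr (_, _); apply/ffunP=> p; rewrite !ffunE.
  by rewrite -(ux p) u0 ffunE.
by apply/eqP; rewrite -oppr_eq0 -(net_current_inp (x1, x2)) -lap u0 laplacian0.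
Qed.

Lemma rel_ker_conv_behavior0 :
    (forall u, (forall p, u (inp N p) = 0) ->
      (forall v, v \notin outputs N -> laplacian u v = 0) -> u = 0) ->
  rel_ker (rel_conv (behavior N)) = 0%VS.
Proof.
move=> uniq0; apply/eqP; rewrite -subv0; apply/subvP=> -[y1 y2].
rewrite mem_rel_ker mem_rel_conv => /mem_behavior[u [ux uy lap]].
have u0 : u = 0.
  apply: uniq0 => [p|v vO]; first by rewrite ux ffunE.
  by rewrite lap net_current_notin_outputs.
rewrite memv0; apply/eqP; congr (_, _); apply/ffunP=> q; rewrite !ffunE.
  by rewrite -(uy q) u0 ffunE.
by rewrite -(net_current_outp (y1, y2)) -lap u0 laplacian0.
Qed.

Lemma inputs_full_ker_conv :
  inputs N = setT -> rel_ker (rel_conv (behavior N)) = 0%VS.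
Proof.
move=> iT; apply: rel_ker_conv_behavior0 => u u0 _; apply/ffunP=> v.
by have := in_setT v; rewrite -iT => /imsetP[p _ ->]; rewrite u0 ffunE.
Qed.

Lemma outputs_full_ker :
  outputs N = setT -> rel_ker (behavior N) = 0%VS.
Proof.
move=> oT; apply: rel_ker_behavior0 => u u0 _; apply/ffunP=> v.
by have := in_setT v; rewrite -oT => /imsetP[p _ ->]; rewrite u0 ffunE.
Qed.

Lemma behavior_dim_bounds : inputs N :|: outputs N = setT ->
  [/\ (#|P| + #|Q| <= \dim (rel_ker (behavior N)) + \dim (rel_im (behavior N)))%N,
      (\dim (rel_ker (behavior N)) + \dim (rel_im (behavior N))
       = \dim (rel_ker (rel_conv (behavior N)))
         + \dim (rel_im (rel_conv (behavior N))))%N,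
      (\dim (rel_im (behavior N)) <= 2 * #|Q|)%N
    & (\dim (rel_im (rel_conv (behavior N))) <= 2 * #|P|)%N].
Proof.
move=> /behavior_dim_ge ge; rewrite dim_rel dim_rel_conv; split=> //.
  by rewrite -(dim_bdspace F) -dimvf dimvS ?subvf.
by rewrite -(dim_bdspace F) -dimvf dimvS ?subvf.
Qed.

(** The kernels and the lower bound on the dimension of the behavior give images of dimension at
    least |Q| + k and |P| + k. If k = |Q| the first bound meets the maximum 2|Q|, which fixes the
    total dimension and hence the other image; k = |P| is symmetric. *)
Lemma good_intro k : inputs N :|: outputs N = setT ->
    (\dim (rel_ker (behavior N)) + k)%N = #|P| ->
    (\dim (rel_ker (rel_conv (behavior N))) + k)%N = #|Q| ->
    k = #|P| \/ k = #|Q| ->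
    (exists (I : finType) (a : I -> P) (b : I -> Q), #|I| = k /\ linkage N a b) ->
  good N k.
Proof.
move=> /behavior_dim_bounds[b1 b2 b3 b4] dk dkc kPQ lk.
split=> //; [by split=> //; lia|by split=> //; lia|].
(* The cut is the set of all inputs or of all outputs, according to which label set has size k. *)
case: kPQ => ->; first by exists setT, (inputs _); apply: vertex_cut_inputs.
exists (outputs N), (outputs N); split; last exact: leq_imset_card.
by split=> //; apply: subsetIr.
Qed.

(** With both kernels zero, |P| + |Q| is at most 2|Q| and at most 2|P|, which forces |P| = |Q|. *)
Lemma good_bijective (b : P -> Q) : inputs N :|: outputs N = setT ->
    rel_ker (behavior N) = 0%VS -> rel_ker (rel_conv (behavior N)) = 0%VS ->
  linkage N id b -> good N #|P| /\ #|P| = #|Q|.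
Proof.
move=> io k0 kc0 lk.
have PQ : #|P| = #|Q|.
  by have [] := behavior_dim_bounds io; rewrite k0 kc0 !dimv0; lia.
split=> //; apply: good_intro => //.
- by rewrite k0 dimv0.
- by rewrite kc0 dimv0 PQ.
- by left.
- by exists P, id, b.
Qed.

Lemma type2_good : type2 N -> good N #|P| /\ #|P| = #|Q|.
Proof.
case/andP=> /eqP iT /eqP oT.
have /fin_all_exists[b bP] p : exists q, inp N p = outp N q.
  by have := in_setT (inp N p); rewrite -oT => /imsetP[q _ ->]; exists q.
apply: (good_bijective (b := b)).
- by rewrite iT setTU.
- exact: outputs_full_ker.
- exact: inputs_full_ker_conv.
- exact: linkage_trivial.
Qed.

Lemma laplacian_edgeless u v : #|oedge N| = 0%N -> laplacian u v = 0.
Proof.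
by move/card0_eq=> E0; rewrite /laplacian big_pred0 // => e; have := E0 e.
Qed.

(** Without edges all currents in the kernel vanish, and so do the potentials at outputs; those at
    the stubs are free, which gives dimension |P| - |Q|. *)
Lemma type3_good : type3 N -> good N #|Q|.
Proof.
case/and3P=> /eqP E0 /eqP iT _.
have /fin_all_exists[a aP] q : exists p, inp N p = outp N q.
  by have := in_setT (outp N q); rewrite -iT => /imsetP[p _ ->]; exists p.
have a_inj : injective a
  by move=> q q' qq; apply: (@outp_inj _ _ _ N); rewrite -!aP qq.
apply: good_intro; [by rewrite iT setTU| | |by right|]; last first.
- by exists Q, a, id; split=> //; apply: linkage_trivial.
- by rewrite inputs_full_ker_conv // dimv0.
apply: dim_restriction_ker a_inj _ => -[x1 x2]; rewrite mem_rel_ker mem_behavior.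
split=> [[u [ux uy lap]]|/= [-> x0]].
  split=> [|q] /=; last by rewrite -[x1 _]ux aP uy ffunE.
  apply/ffunP=> p; rewrite ffunE; apply/eqP.
  rewrite -oppr_eq0 -[x2 p]/((x1, x2).2 p) -net_current_inp -lap.
  by rewrite laplacian_edgeless.
pose u : fspace F (vertex N) :=
  [ffun v => if [pick p | inp N p == v] is Some p then x1 p else 0].
have ux p : u (inp N p) = x1 p.
  by rewrite ffunE; case: pickP => [p' /eqP/inp_inj->|/(_ p)]; rewrite ?eqxx.
exists u; split=> [p|q|v] //; first by rewrite -aP ux x0 ffunE.
have := in_setT v; rewrite -iT => /imsetP[p _ ->].
by rewrite laplacian_edgeless // net_current_inp ffunE oppr0.
Qed.

Lemma type4_good : type4 N -> good N #|P|.
Proof.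
case/and3P=> /eqP E0 /eqP oT _.
have /fin_all_exists[b bP] p : exists q, inp N p = outp N q.
  by have := in_setT (inp N p); rewrite -oT => /imsetP[q _ ->]; exists q.
have b_inj : injective b
  by move=> p p' pp; apply: (@inp_inj _ _ _ N); rewrite !bP pp.
apply: good_intro; [by rewrite oT setUT| | |by left|]; last first.
- by exists P, id, b; split=> //; apply: linkage_trivial.
- apply: dim_restriction_ker b_inj _ => -[y1 y2].
  rewrite mem_rel_ker mem_rel_conv mem_behavior.
  split=> [[u [ux uy lap]]|/= [-> y0]].
    split=> [|p] /=; last by rewrite -[y1 _]uy -bP ux ffunE.
    apply/ffunP=> q; rewrite ffunE.
    by rewrite -[y2 q]/((y1, y2).2 q) -net_current_outp -lap laplacian_edgeless.
  pose u : fspace F (vertex N) :=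
    [ffun v => if [pick q | outp N q == v] is Some q then y1 q else 0].
  have uy q : u (outp N q) = y1 q.
    by rewrite ffunE; case: pickP => [q' /eqP/outp_inj->|/(_ q)]; rewrite ?eqxx.
  exists u; split=> [p|q|v] //; first by rewrite bP uy y0 ffunE.
  have := in_setT v; rewrite -oT => /imsetP[q _ ->].
  by rewrite laplacian_edgeless // net_current_outp ffunE.
- by rewrite outputs_full_ker // dimv0.
Qed.

(** The last two clauses say that both endpoints have degree one, in the form that reduces each
    Laplacian sum to a single term. *)
Definition type1_edge (e : oedge N) : Prop :=
  [/\ etail e \in inputs N :\: outputs N, ehead e \in outputs N :\: inputs N,
      forall f : oedge N, ehead f = ehead e -> f = e
    & forall f : oedge N, ehead f = etail e -> f = erev e].

Lemma type1P v : type1 N ->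
  v \in inputs N /\ v \in outputs N
  \/ exists2 e, type1_edge e & v = etail e \/ v = ehead e.
Proof.
move/forallP/(_ v)/orP=> [/and3P[_ vI vO]|]; first by left.
case/existsP=> e /and5P[th /eqP cE /eqP fE te he]; right; exists e; last first.
  have : v \in component v by rewrite inE connect0.
  by rewrite cE => /set2P.
have edges (f : oedge N) : ehead f \in component v -> f = e \/ f = erev e.
  by move=> fc; apply/set2P; rewrite -fE inE.
split=> // f fe; case: (edges f) => //; rewrite ?cE ?fe ?set21 ?set22 //.
  by move=> fE'; case/eqP: th; rewrite -fe fE'.
by move=> fE'; case/eqP: th; rewrite -fe fE'.
Qed.

Lemma type1_edge_laplacian u e : type1_edge e ->
  laplacian u (ehead e) = weight e * (u (ehead e) - u (etail e)) /\
  laplacian u (etail e) = weight e * (u (etail e) - u (ehead e)).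
Proof.
case=> _ _ he te; rewrite /laplacian; split.
  rewrite (eq_bigl (pred1 e)) ?big_pred1_eq // => f /=.
  by apply/eqP/eqP=> [/he|->].
rewrite (eq_bigl (pred1 (erev e))) ?big_pred1_eq /etail ?erevK ?weight_rev //.
by move=> f /=; apply/eqP/eqP=> [/te|->].
Qed.

Lemma type1_good : type1 N -> good N #|P| /\ #|P| = #|Q|.
Proof.
move=> t1.
(* Choose for each input its trail, of no edge or one edge, together with the output it reaches. *)
have /fin_all_exists[g gP] p : exists r : seq (oedge N) * Q,
    r.1 = [::] /\ outp N r.2 = inp N p
    \/ exists e, [/\ r.1 = [:: e], type1_edge e, etail e = inp N p
                   & ehead e = outp N r.2].
  case: (type1P (inp N p) t1) => [[_ /imsetP[q _ pq]]|[e be [pe|pe]]].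
  - by exists ([::], q); left.
  - have [_ /setDP[/imsetP[q _ eq] _] _ _] := be.
    by exists ([:: e], q); right; exists e.
  - by have [_ /setDP[_]] := be; rewrite -pe imset_f.
apply: (good_bijective (b := fun p => (g p).2)).
- apply/setP=> v; rewrite !inE.
  case: (type1P v t1) => [[-> _] //|[e [/setDP[te _] /setDP[he _] _ _] [->|->]]].
    by rewrite te.
  by rewrite he orbT.
- apply: rel_ker_behavior0 => u u0 lap; apply/ffunP=> v; rewrite ffunE.
  case: (type1P v t1) => [[_ /imsetP[q _ ->]] //|[e be]].
  have [_ /setDP[/imsetP[q _ hq] hI] _ _] := be.
  have := lap _ hI; have [-> _] := type1_edge_laplacian u be.
  (* The Laplacian vanishes at the output end, so by the nonzero weight the potential at the input
     end equals that at the output end, which is zero. *)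
  move/eqP; rewrite mulf_eq0 (negPf (weight_neq0 _)) hq u0 sub0r oppr_eq0 /=.
  by move=> /eqP t0 [->|->].
- apply: rel_ker_conv_behavior0 => u u0 lap; apply/ffunP=> v; rewrite ffunE.
  case: (type1P v t1) => [[/imsetP[q _ ->] _] //|[e be]].
  have [/setDP[/imsetP[p _ tp] tO] _ _ _] := be.
  have := lap _ tO; have [_ ->] := type1_edge_laplacian u be.
  move/eqP; rewrite mulf_eq0 (negPf (weight_neq0 _)) tp u0 sub0r oppr_eq0 /=.
  by move=> /eqP t0 [->|->].
exists (fun p => (g p).1); split=> [p|p|p p'|p q|p p' v] /=.
- case: (gP p) => [[-> _] //|[e [-> [tIO hIO _ _] te _]]] /=.
  rewrite te eqxx /= !andbT inE -te; apply/eqP=> th.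
  by move: tIO hIO; rewrite th => /setDP[_ /negP h] /setDP[/h].
- by case: (gP p) => [[-> ->] //|[e [-> _ _ <-]]].
- case: (gP p) => [[-> _]|[e [-> [_ /setDP[_ hI] _ _] te _]]] /=.
    by rewrite inE => /eqP/inp_inj.
  rewrite !inE => /orP[/eqP/inp_inj //|/eqP pe].
  by rewrite -pe imset_f in hI.
- case: (gP p) => [[-> <-]|[e [-> [/setDP[_ tO] _ _ _] te he]]] /=.
    by rewrite inE => /eqP/outp_inj.
  rewrite !inE -te he => /orP[/eqP qe|/eqP/outp_inj //].
  by rewrite -qe imset_f in tO.
have trailP i : v \in trail (inp N i) (g i).1 -> v = inp N i
    \/ exists e, [/\ type1_edge e, etail e = inp N i & v = ehead e].
  case: (gP i) => [[-> _]|[e [-> be te he]]]; rewrite !inE ?orbF;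
    first by move/eqP; left.
  by case/orP=> /eqP; [left|right; exists e].
move=> /trailP[vE|[e [be te vE]]] /trailP[vE'|[e' [be' te' vE']]]; subst v.
- exact: inp_inj vE'.
- by have [_ /setDP[_]] := be'; rewrite -vE' imset_f.
- by have [_ /setDP[_]] := be; rewrite vE' imset_f.
(* Two edges with the same head coincide, as the head has degree one. *)
have [_ _ /(_ _ (esym vE')) ee' _] := be.
by apply: (@inp_inj _ _ _ N); rewrite -te -te' ee'.
Qed.

End Elementary.

(** * Induction along the factorization *)

Section Chains.
Variable F : fieldType.

Lemma elementary_good_reduction P Q (N : ionet F P Q) :
  elementary N -> ~~ type4 N -> good N #|Q|.
Proof.
case/or4P=> [/type1_good[h <-]|/type2_good[h <-]|/type3_good|->] //.
Qed.

Lemma elementary_good_extension P Q (N : ionet F P Q) :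
  elementary N -> ~~ type3 N -> good N #|P|.
Proof.
case/or4P=> [/type1_good[]|/type2_good[]|->|/type4_good] //.
Qed.

Lemma chain_good_extension P Q (c : chain F P Q) :
    chain_all (@elementary F) c ->
    chain_all (fun P Q (N : ionet F P Q) => ~~ type3 N) c ->
  good (chain_comp c) #|P|.
Proof.
elim: c => {P Q} [P Q N|P R Q N c IH] /=; first exact: elementary_good_extension.
case/andP=> eN ec /andP[tN tc]; apply: good_comp_extension (IH ec tc).
exact: elementary_good_extension.
Qed.

(** The k found is the number of labels just before the first factor of type 4, or |Q| if there is
    none. *)
Lemma chain_good P Q (c : chain F P Q) :
  chain_all (@elementary F) c -> type3_before_type4 c ->
  exists k, good (chain_comp c) k.
Proof.
elim: c => {P Q} [P Q N|P R Q N c IH] /=.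
  case: (boolP (type4 N)) => [t4 _ _|t4 eN _].
    by exists #|P|; apply: type4_good.
  by exists #|Q|; apply: elementary_good_reduction.
case/andP=> eN ec; case: (boolP (type4 N)) => [t4 /andP[tc _]|t4 /andP[_ bc]].
  exists #|P|; apply: good_comp_extension (chain_good_extension ec tc).
  exact: type4_good.
have [k gk] := IH ec bc; exists k; apply: good_comp_reduction gk.
exact: elementary_good_reduction.
Qed.

End Chains.

Theorem mainTheorem6 (F : fieldType) (P Q : finType) (N : ionet F P Q)
    (hN : has_elementary_factorization N) :
  [/\ rel_rank (behavior N) = (2 * mconn N)%:Z,
      (\dim (rel_ker (behavior N)))%:Z = #|P|%:Z - (mconn N)%:Z
    & (\dim (rel_im (rel_conv (behavior N))))%:Z = #|P|%:Z + (mconn N)%:Z]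
  /\
  [/\ rel_rank (rel_conv (behavior N)) = (2 * mconn N)%:Z,
      (\dim (rel_ker (rel_conv (behavior N))))%:Z = #|Q|%:Z - (mconn N)%:Z
    & (\dim (rel_im (behavior N)))%:Z = #|Q|%:Z + (mconn N)%:Z].
Proof.
case: hN => c [ec bc /ionet_iso_sym iso].
have [k /(good_iso iso) gk] := chain_good ec bc.
rewrite /rel_rank rel_convK (good_mconn gk).
case: gk => [[dk dic] [dkc di] _ _].
by split; split; lia.
Qed.
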